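(* Let $X$ be a compact metric space with distance $d$, $f\colon X\to\mathbb R^q$ $L$-Lipschitz, $S\subset X$ compact, and $\mu$ a Radon measure on $X$. Let $\delta>0$, $w\in\mathbb S^{q-1}$, $\alpha\in(0,\pi/2)$ and assume that $S$ is $\operatorname{Frag}(X,f,\delta,w,\alpha)$-null. Denote by $d_{\delta,\alpha},\tilde d_{\delta,\alpha}$ the distances $$d_{\delta,\alpha}(x,y)=\delta\,d(x,y)+\cot\alpha\,\|\pi_w^\perp f(x)-\pi_w^\perp f(y)\|_2,\qquad \tilde d_{\delta,\alpha}=\max(L\,d,\,d_{\delta,\alpha}).$$ Then there are functions $g_k\colon X\to\mathbb R$ which are $1$-Lipschitz with respect to $\tilde d_{\delta,\alpha}$, with $g_k\to\langle w,f\rangle$ weak*, and such that each $g_k$ is $\mu$-a.e. locally $1$-Lipschitz on $S$ with respect to $d_{\delta,\alpha}$.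
   Context: $\pi_w^\perp$ is the orthogonal projection of $\mathbb R^q$ onto the orthogonal complement of $w$. The open cone is $\mathcal C(w,\alpha)=\{u\in\mathbb R^q:\tan\alpha\,\langle w,u\rangle>\|\pi_w^\perp u\|_2\}$. A fragment in $X$ is a bi-Lipschitz map $\gamma\colon K\to X$ with $K=\operatorname{dom}\gamma\subset\mathbb R$ compact of positive Lebesgue measure. The metric differential is $\operatorname{md}\gamma(t)=\lim_{\operatorname{dom}\gamma\ni t'\to t}d(\gamma(t'),\gamma(t))/|t'-t|$; $(f\circ\gamma)'(t)$ is likewise computed along $\operatorname{dom}\gamma$ (both exist for a.e. $t$). $\operatorname{Frag}(X,f,\delta,w,\alpha)$ is the set of fragments $\gamma$ in $X$ such that, for a.e. $t\in\operatorname{dom}\gamma$, $(\langle w,f\rangle\circ\gamma)'(t)\ge\delta\operatorname{md}\gamma(t)$ and $(f\circ\gamma)'(t)\in\mathcal C(w,\alpha)$. For a family $\mathcal G$ of fragments, a Borel set $S$ is $\mathcal G$-null if for each $\gamma\in\mathcal G$ the 1-dimensional Hausdorff measure of $S\cap\gamma(\operatorname{dom}\gamma)$ is zero. Weak* convergence means pointwise convergence with uniformly bounded global Lipschitz constants (with respect to $d$). ''$\mu$-a.e. locally $1$-Lipschitz on $S$ with respect to $d_{\delta,\alpha}$'' means that for $\mu$-a.e. $x\in S$ there is $r>0$ such that the restriction to the ball $B(x,r)$ (for $d$) is $1$-Lipschitz with respect to $d_{\delta,\alpha}$. *)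

(* Defs.v *)
From HB Require Import structures.
From mathcomp Require Import all_boot all_order all_algebra.
From mathcomp Require Import all_classical all_reals all_analysis.

Set Implicit Arguments.
Unset Strict Implicit.
Unset Printing Implicit Defensive.

Import Order.TTheory GRing.Theory Num.Theory.
Import numFieldNormedType.Exports.

Local Open Scope classical_set_scope.
Local Open Scope ring_scope.

(* Measurable types are pointed, so metric spaces carrying measures have to be
   pointed as well, i.e. nonempty. *)
#[short(type="pmetricType")]
HB.structure Definition PMetric (R : numDomainType) :=
  { X of Metric R X & Pointed X }.

Section Euclidean.
Context {R : realType} {q : nat}.
Implicit Types u v w : 'rV[R]_q.

(* The norm [`|u|] of the library on ['rV[R]_q] is the sup norm. *)
Definition dotp u v : R := \sum_(i < q) u 0 i * v 0 i.

Definition norm2 u : R := Num.sqrt (dotp u u).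

Definition proj_perp w u : 'rV[R]_q := u - (dotp w u / dotp w w) *: w.

Definition cone w (alpha : R) : set 'rV[R]_q :=
  [set u | norm2 (proj_perp w u) < tan alpha * dotp w u].

End Euclidean.

Definition cot {R : realType} (alpha : R) : R := cos alpha / sin alpha.

Section Hausdorff.
Context {R : realType} {X : metricType R}.
Implicit Types A : set X.
Local Open Scope ereal_scope.

(* 0 is adjoined so that the empty set has diameter 0 and not -oo. *)
Definition diam A : \bar R :=
  ereal_sup ([set 0] `|` [set (mdist p.1 p.2)%:E | p in A `*` A]).

Definition hausdorff1_pre (eps : R) A : \bar R :=
  ereal_inf [set \sum_(0 <= k <oo) diam (E k) | E in
    [set E : (set X)^nat |
      A `<=` \bigcup_k E k /\ forall k, diam (E k) <= eps%:E]].

Definition hausdorff1 A : \bar R :=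
  ereal_sup [set hausdorff1_pre eps A | eps in [set eps : R | (0 < eps)%R]].

End Hausdorff.

Section Fragments.
Context {R : realType} {X : metricType R}.

(* A map K -> X is represented by a total map R -> X; its values outside of
   [fdom] are never used. *)
Record fragment := Fragment {
  fdom : set R ;
  fmap :> R -> X ;
  fdom_compact : compact fdom ;
  fdom_measure_gt0 : (0 < lebesgue_measure fdom)%E ;
  fmap_bilip : exists2 C : R, 0 < C &
    forall s t, fdom s -> fdom t ->
      C^-1 * `|s - t| <= mdist (fmap s) (fmap t) <= C * `|s - t| }.

Definition md_quotient (gamma : fragment) (t t' : R) : R :=
  mdist (gamma t') (gamma t) / `|t' - t|.

Definition md (gamma : fragment) (t : R) : R :=
  lim (md_quotient gamma t t' @[t' --> within (fdom gamma) t^']).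

Definition diff_quotient {V : normedModType R} (h : R -> V) (t t' : R) : V :=
  (t' - t)^-1 *: (h t' - h t).

Definition derive_in {V : normedModType R} (K : set R) (h : R -> V) (t : R) : V :=
  lim (diff_quotient h t t' @[t' --> within K t^']).

(* [lim] is a total operator, hence the explicit existence of the limits; the
   differentiability of [<w, f> \o gamma] follows from that of [f \o gamma]. *)
Definition Frag {q : nat} (f : X -> 'rV[R]_q) (delta : R) (w : 'rV[R]_q)
    (alpha : R) : set fragment :=
  [set gamma | {ae lebesgue_measure, forall t, fdom gamma t ->
    [/\ cvg (md_quotient gamma t t' @[t' --> within (fdom gamma) t^']),
        cvg (diff_quotient (f \o gamma) t t'
               @[t' --> within (fdom gamma) t^']),
        delta * md gamma t <=
          derive_in (fdom gamma) (fun s => dotp w (f (gamma s)) : R^o) t &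
        cone w alpha (derive_in (fdom gamma) (f \o gamma) t)]}].

Definition family_null (G : set fragment) (S : set X) : Prop :=
  forall gamma, G gamma -> hausdorff1 (S `&` gamma @` fdom gamma) = 0%E.

End Fragments.
Arguments fragment {R} X.

Section Lipschitz.
Context {R : realType} {X : metricType R}.

Definition lipschitz_wrt (rho : X -> X -> R) (C : R) (A : set X) (g : X -> R) :=
  forall x y, A x -> A y -> `|g x - g y| <= C * rho x y.

Definition weak_star_cvg (g : nat -> X -> R) (h : X -> R) : Prop :=
  (exists C : R, forall k, lipschitz_wrt mdist C setT (g k)) /\
  forall x, g k x @[k --> \oo] --> h x.

Context {q : nat} (f : X -> 'rV[R]_q).

Definition lipschitz2 (L : R) :=
  forall x y, norm2 (f x - f y) <= L * mdist x y.

Definition dist_cone (delta : R) (w : 'rV[R]_q) (alpha : R) (x y : X) : R :=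
  delta * mdist x y
  + cot alpha * norm2 (proj_perp w (f x) - proj_perp w (f y)).

Definition dist_cone_max (L delta : R) (w : 'rV[R]_q) (alpha : R) (x y : X) : R :=
  Num.max (L * mdist x y) (dist_cone delta w alpha x y).

End Lipschitz.

Section Radon.
Context {R : realType} {X : pmetricType R}.

Definition borelType := g_sigma_algebraType (@open X).

Definition radon (mu : set borelType -> \bar R) : Prop :=
  (forall K : set X, compact K -> (mu K < +oo)%E) /\
  (forall A : set borelType, measurable A ->
     mu A = ereal_sup [set mu K | K in [set K : set X | compact K /\ K `<=` A]]).

Definition ae_locally_lip1 (mu : {measure set borelType -> \bar R}) (S : set X)
    (rho : X -> X -> R) (g : X -> R) : Prop :=
  {ae mu, forall x, S x ->
    exists2 r : R, 0 < r & lipschitz_wrt rho 1 (ball (x : X) r) g}.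

End Radon.
Arguments borelType {R} X.

(* Main.v *)
Require Import Defs.
From HB Require Import structures.
From mathcomp Require Import all_boot all_order all_algebra.
From mathcomp Require Import all_classical all_reals all_analysis.
From mathcomp Require Import measurable_realfun.
From mathcomp Require Import ring lra.

Set Implicit Arguments.
Unset Strict Implicit.
Unset Printing Implicit Defensive.

Import Order.TTheory GRing.Theory Num.Theory.
Import numFieldNormedType.Exports.

Local Open Scope classical_set_scope.
Local Open Scope ring_scope.

(** Write F for <w, f> and D for the distance d_{delta,alpha}. The functions g_k
    are relaxations of F. A step between two points lying in a common ball of
    radius r = 1/(k+1) centred on S costs D, any other step costs max(L d, D),
    and g_k x is the infimum, over the finite chains of points ending at x, of
    the value of F at the first point plus the cost of the chain
    ([relaxation]). Lengthening a chain by one step shows that g_k is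
    1-Lipschitz for the cost of a single step, which gives both Lipschitz
    bounds, the local one near every point of S ([relaxation_lipschitz]).
    The one-point chain gives g_k <= F. The matter is that g_k tends to F.

    Suppose that g_k x < F x - e for arbitrarily large k. Along a chain with
    this defect let phi be the increase of F minus the cost paid so far; phi
    goes from 0 to at least e. Following F. Riesz's rising sun lemma, send
    v in ]0, e] to the first point of the chain at which phi >= v. The step
    arriving there gains more than it costs, so it is a short step near S:
    elsewhere the cost L d already exceeds the variation of F. Since phi
    increases between two successive such points, F increases between them by
    at least the cost, hence by at least D, and also by at least the increase
    of phi, which is v' - v up to an overshoot of order r ([rising_sun]).
    These inequalities between pairs of points are stable under limits as
    r -> 0: along an ultrafilter the points converge, by compactness, to a map
    x from ]0, e] to S with |F (x v) - F (x v')| >= D (x v) (x v') and >= |v - v'|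
    ([monotone_net_limit]).

    The closure G of the range of x is then a compact subset of S on which
    D p p' <= |F p - F p'|. Consequently F is bi-Lipschitz on G and its inverse
    is a fragment parametrised by height: (F o gamma)' = 1, while the
    inequality, divided by |t - t'|, gives delta md gamma <= 1 in the limit and
    confines (f o gamma)' to the cone, strictly because md gamma > 0
    ([chain_fragment]). As x expands distances, F(G) has positive
    Lebesgue measure and G has positive Hausdorff measure
    ([expanding_image_gt0], [expanding_hausdorff1_neq0]), which contradicts
    the nullity of S ([null_no_monotone_curve]).

    What remains is the almost everywhere existence of the derivative of
    f o gamma and of the metric differential. A Lipschitz function of one
    variable is, up to a linear term, the distribution function of a measure
    dominated by Lebesgue measure; the Radon-Nikodym theorem and Lebesgue's
    differentiation theorem give its derivative ([lipschitz_density]). For a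
    curve gamma in a metric space this is applied to the distances to a
    countable dense set of points z_i of the curve; md gamma is the supremum of
    the absolute values of their derivatives ([metric_differential]). *)

(** * Null sets and coverings of the line *)

Section Stieltjes.
Context {R : realType}.
Local Notation leb := (@lebesgue_measure R).

(** The measure is the outer measure generated by half-open intervals, so a null
    set can be covered by such intervals of small total length. *)
Lemma lebesgue_null_cover (A : set R) (e : R) :
  leb A = 0%E -> 0 < e ->
  exists2 I : nat -> R * R, (forall k, (I k).1 <= (I k).2) /\
      A `<=` \bigcup_k `](I k).1, (I k).2]%classic &
    (\sum_(0 <= k <oo) ((I k).2 - (I k).1)%:E < e%:E)%E.
Proof.
rewrite /lebesgue_measure /lebesgue_stieltjes_measure /measure_extension.
move=> A0 e0.
have : (mu_ext (wlength idfun) A < e%:E)%E by rewrite A0 lte_fin.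
rewrite /mu_ext => /ereal_inf_lt[_ [F [mF AF] <-] Fe].
have HF k : exists I : R * R, I.1 <= I.2 /\ F k = `]I.1, I.2]%classic.
  have /ocitvP[->|[x x12 ->]] := mF k; last by exists x; split => //; exact: ltW.
  exists (0, 0); split; first exact: lexx.
  by apply/esym/set_itv_ge; rewrite bnd_simp ltxx.
have [I HI] := choice HF.
exists I; first split.
- by move=> k; have [] := HI k.
- by move=> x /AF[k _]; have [_ ->] := HI k; exists k.
apply: le_lt_trans Fe; rewrite le_eqVlt; apply/orP; left; apply/eqP.
apply: eq_eseriesr => k _; have [Ik ->] := HI k.
by rewrite wlength_itv_bnd.
Qed.

(** Both measures come from the same coverings by half-open intervals, and on
    these the Stieltjes length is at most C times the length. *)
Lemma stieltjes_lipschitz_null (g : cumulative R R) (C : R) (A : set R) :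
  (forall x y, x <= y -> g y - g x <= C * (y - x)) ->
  leb A = 0%E -> lebesgue_stieltjes_measure g A = 0%E.
Proof.
move=> gC A0; apply/eqP; rewrite eq_le measure_ge0 andbT.
apply/lee_addgt0Pr => e e0; rewrite add0e.
have C0 : 0 < `|C| + 1 by rewrite ltr_wpDl.
have [I [I12 AI] Ie] := lebesgue_null_cover A0 (divr_gt0 e0 C0).
apply: (@le_trans _ _
  (\sum_(0 <= k <oo) wlength g `](I k).1, (I k).2]%classic)%E).
  apply: ereal_inf_lbound => /=; exists (fun k => `](I k).1, (I k).2]%classic) => //.
  by split => // k; exact: is_ocitv.
apply: (@le_trans _ _ (\sum_(0 <= k <oo)
    ((`|C| + 1)%:E * ((I k).2 - (I k).1)%:E))%E).
  apply: lee_nneseries => k.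
    by move=> _ _; exact: wlength_ge0.
  move=> _; rewrite wlength_itv_bnd// -EFinM lee_fin (le_trans (gC _ _ (I12 k)))//.
  by rewrite ler_wpM2r ?subr_ge0// (le_trans (ler_norm _))// lerDl.
rewrite nneseriesZl; last by move=> k _; rewrite lee_fin subr_ge0.
by rewrite -lee_pdivlMl// -EFinM mulrC ltW.
Qed.

End Stieltjes.

Section Covering.
Context {R : realType}.
Local Notation leb := (@lebesgue_measure R).

(** Each piece lies in the interval between its infimum and its supremum, whose
    length is the diameter of the piece; the lengths then add up by countable
    subadditivity. The numbers d k bound the diameters from above, which suits
    pieces that are preimages under an expanding map. *)
Lemma length_le_cover_diam (e : R) (E : nat -> set R) (d : nat -> \bar R) :
  (forall k, 0 <= d k)%E -> 0 <= e -> `]0, e] `<=` \bigcup_k E k ->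
  (forall k v v', 0 < v <= e -> 0 < v' <= e -> E k v -> E k v' ->
    (`|v - v'|%:E <= d k)%E) ->
  (e%:E <= \sum_(0 <= k <oo) d k)%E.
Proof.
move=> d0 e0 cov dE.
have HJ k : exists I : interval R,
    `]0, e]%classic `&` E k `<=` [set` I] /\ (leb [set` I] <= d k)%E.
  pose A := `]0, e]%classic `&` E k; have [A0|A0] := pselect (A !=set0); last first.
    exists `]0, 0[; split.
      by move=> x Ax; exfalso; apply: A0; exists x.
    by rewrite lebesgue_measure_itv/= lte_fin ltxx.
  have hs : has_sup A.
    by split=> //; exists e => x [/=]; rewrite in_itv/= => /andP[].
  have hi : has_inf A.
    by split=> //; exists 0 => x [/=]; rewrite in_itv/= => /andP[/ltW].
  exists `[inf A, sup A]; split.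
    move=> x Ax; rewrite /= in_itv/=; apply/andP; split.
      by apply: ge_inf => //; exact: hi.2.
    by apply: ub_le_sup => //; exact: hs.2.
  rewrite lebesgue_measure_itv/= lte_fin; case: ltP => // _.
  case dk : (d k) => [r| |]; [|by rewrite leey|by have := d0 k; rewrite dk].
  rewrite -EFinB lee_fin lerBlDr; apply: ge_sup => // v Av.
  rewrite -lerBlDl; apply: lb_le_inf => // v' Av'; rewrite lerBlDl -lerBlDr.
  have [] := (Av, Av'); rewrite /A/= in_itv/= => -[v0 Ev] [v'0 Ev'].
  have := dE k v v' v0 v'0 Ev Ev'; rewrite dk lee_fin.
  exact: le_trans (ler_norm _).
have [I HI] := choice HJ.
have -> : e%:E = leb `]0, e]%classic.
  rewrite lebesgue_measure_itv/= lte_fin; case: ltP => [_|e0'].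
    by rewrite -EFinB subr0.
  by congr EFin; apply/eqP; rewrite eq_le e0 e0'.
apply: (@le_trans _ _ (leb (\bigcup_k [set` I k]))).
  apply: le_measure; rewrite ?inE//.
    by apply: bigcupT_measurable => k; exact: measurable_itv.
  move=> v v0; have [k _ Ekv] := cov _ v0; exists k => //.
  by have [+ _] := HI k; apply.
apply: (@le_trans _ _ (\sum_(0 <= k <oo) leb [set` I k])%E).
  apply: measure_sigma_subadditive => //.
  by apply: bigcupT_measurable => k; exact: measurable_itv.
by apply: lee_nneseries => // k _; have [] := HI k.
Qed.

(** A covering of A by intervals pulls back to a covering of ]0, e] by sets that
    are no longer than these intervals. *)
Lemma expanding_image_gt0 (u : R -> R) (A : set R) (e : R) :
  0 < e -> (forall v v', 0 < v <= e -> 0 < v' <= e -> `|v - v'| <= `|u v - u v'|) ->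
  (forall v, 0 < v <= e -> A (u v)) -> (0 < leb A)%E.
Proof.
move=> e0 ue uA; rewrite lt0e measure_ge0 andbT; apply/eqP => A0.
have [I [I12 AI] Ie] := lebesgue_null_cover A0 e0.
have : (e%:E <= \sum_(0 <= k <oo) ((I k).2 - (I k).1)%:E)%E; last by rewrite leNgt Ie.
apply: (@length_le_cover_diam e (fun k => u @^-1` `](I k).1, (I k).2])).
- by move=> k; rewrite lee_fin subr_ge0.
- exact: ltW.
- move=> v; rewrite /= in_itv/= => /uA /AI [k _ Iv]; by exists k.
- move=> k v v' v0 v'0; rewrite /= !in_itv/= => /andP[? ?] /andP[? ?].
  rewrite lee_fin (le_trans (ue _ _ v0 v'0))// ler_norml.
  by apply/andP; split; lra.
Qed.

(** The same pull-back argument bounds from below the sum of the diameters of any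
    covering of A by e / C, whatever the mesh of the covering. *)
Lemma expanding_hausdorff1_neq0 {X : metricType R} (x : R -> X) (A : set X) (e C : R) :
  0 < e -> 0 < C ->
  (forall v v', 0 < v <= e -> 0 < v' <= e -> `|v - v'| <= C * mdist (x v) (x v')) ->
  (forall v, 0 < v <= e -> A (x v)) -> hausdorff1 A <> 0%E.
Proof.
move=> e0 C0 xC xA A0.
have : (hausdorff1_pre 1 A < (e / C)%:E)%E.
  apply: (@le_lt_trans _ _ (hausdorff1 A)); last by rewrite A0 lte_fin divr_gt0.
  by apply: ereal_sup_ubound; exists 1 => //=.
move=> /ereal_inf_lt[_ [E [AE _] <-]]; apply/negP; rewrite -leNgt.
have diam0 k : (0 <= diam (E k))%E by apply: ereal_sup_ubound; left.
rewrite mulrC EFinM lee_pdivrMl// -nneseriesZl//.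
apply: (@length_le_cover_diam e (fun k => x @^-1` (E k))).
- by move=> k; rewrite mule_ge0// lee_fin ltW.
- exact: ltW.
- move=> v; rewrite /= in_itv/= => /xA /AE [k _ Ev]; by exists k.
- move=> k v v' v0 v'0 Ev Ev'.
  apply: (@le_trans _ _ (C * mdist (x v) (x v'))%:E); first by rewrite lee_fin xC.
  rewrite EFinM lee_pmul2l ?lte_fin//; apply: ereal_sup_ubound; right.
  by exists (x v, x v').
Qed.

End Covering.

(** * Lipschitz functions of one variable *)

Section MonotoneDensity.
Context {R : realType}.
Local Notation leb := (@lebesgue_measure R).

(** The density is the Radon-Nikodym derivative of the Stieltjes measure of g,
    restricted to ]-M, M] to be finite. The bound C makes this measure
    absolutely continuous; Lebesgue's differentiation theorem recovers g' from
    the indefinite integral. *)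
Lemma monotone_lipschitz_density (g : R -> R) (C M : R) :
  nondecreasing g -> continuous g ->
  (forall x y, x <= y -> g y - g x <= C * (y - x)) ->
  exists2 r : R -> R, leb.-integrable setT (EFin \o r) &
    (forall x y, - M <= x -> x <= y -> y <= M ->
      g y - g x = \int[leb]_(t in `]x, y]) r t) /\
    {ae leb, forall t, - M < t -> t < M -> is_derive t 1 g (r t)}.
Proof.
move=> ndg cg gC.
pose gc : cumulative R R := HB.pack g
  (isCumulative.Build R _ R g ndg (right_continuousW cg)).
pose nu := lebesgue_stieltjes_measure gc.
have nu_oc x y : x <= y -> nu `]x, y]%classic = (g y - g x)%:E.
  move=> xy; rewrite /nu /lebesgue_stieltjes_measure /measure_extension.
  rewrite measurable_mu_extE/=; last exact: is_ocitv.
  by rewrite wlength_itv_bnd.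
pose D : set (measurableTypeR R) := `]- M, M]%classic.
have mD : measurable D by exact: measurable_itv.
have nuD : (nu D < +oo)%E.
  have [M0|M0] := leP (- M) M; first by rewrite /D nu_oc// ltry.
  have -> : D = set0 by apply: set_itv_ge; rewrite bnd_simp -leNgt ltW.
  by rewrite [X in (X < _)%E](measure0 (lebesgue_stieltjes_measure gc)).
pose nuM : {finite_measure set (measurableTypeR R) -> \bar R} := mfrestr mD nuD.
have dom : nuM `<< leb.
  apply/null_content_dominatesP => A mA A0.
  apply: (@stieltjes_lipschitz_null _ gc C) => //.
  apply/eqP; rewrite eq_le measure_ge0 andbT -[leRHS]A0.
  by apply: le_measure; rewrite ?inE//; exact: measurableI.
have [f [f0 ffin fint nuE]] :=
  @radon_nikodym_sigma_finite _ _ _ (@lebesgue_measure R) nuM dom.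
have fE : f = EFin \o (fine \o f) by apply/funext => t /=; rewrite fineK.
exists (fine \o f); first by rewrite -fE.
have gE x y : - M <= x -> x <= y -> y <= M ->
    g y - g x = \int[leb]_(t in `]x, y]) (fine \o f) t.
  move=> Mx xy yM; rewrite /Rintegral.
  have -> : (\int[leb]_(t in `]x, y]) ((fine \o f) t)%:E = nuM `]x, y]%classic)%E.
    rewrite nuE; last exact: measurable_itv.
    by apply: eq_integral => t _; rewrite [in RHS]fE.
  have -> : nuM `]x, y]%classic = nu `]x, y]%classic.
    congr (nu _); apply: setIidl.
    by apply: subset_itv; rewrite bnd_simp.
  by rewrite nu_oc.
split=> //.
have locf : locally_integrable setT (fine \o f).
  by apply: open_integrable_locally => //; [exact: openT|rewrite -fE].
have := @FTC1 R (fine \o f) (BRight (- M)) _ locf.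
have intf y : leb.-integrable `]- M, y] (EFin \o (fine \o f)).
  by rewrite -fE; apply: integrableS fint => //; exact: measurable_itv.
move=> /(_ intf); apply: filterS; first exact: (ae_filter_ringOfSetsType leb).
move=> t FTCt Mt tM.
have [//|dF F't] := FTCt _.
set F := fun x : R => \int[leb]_(_ in _) _ in dF F't.
have {}dF : is_derive t 1 F ((fine \o f) t).
  by apply: (DeriveDef dF); rewrite -derive1E; exact: F't.
have gD : is_derive t 1 (F + cst (g (- M))) ((fine \o f) t).
  by rewrite -[(fine \o f) t]addr0; apply: is_deriveD.
apply: near_eq_is_derive gD.
near=> s.
have Ms : - M <= s by apply: ltW; near: s; exact: lt_nbhsr.
have sM : s <= M by apply: ltW; near: s; exact: lt_nbhsl.
by rewrite fctE /F/= -(gE _ _ (lexx _))// subrK.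
Unshelve. all: by end_near. Qed.

End MonotoneDensity.

Section LipschitzDensity.
Context {R : realType}.
Local Notation leb := (@lebesgue_measure R).

(** Difference quotients in the form used for curves defined on a subset of the
    line: the increment is t' - t and the limit can be restricted to a set. *)
Lemma is_derive_quotient (h : R -> R) (t D : R) : is_derive t 1 h D ->
  (h t' - h t) / (t' - t) @[t' --> t^'] --> D.
Proof.
move=> hD; have := ex_derive (is_derive := hD); rewrite /derivable => /cvgP.
have <- := derive_val (is_derive := hD).
rewrite -/(derive h t 1) => /cvgrPdist_le cD.
apply/cvgrPdist_le => e /cD; rewrite /= !near_withinE => H.
have : \forall t' \near t, t' - t != 0 ->
    `|'D_1 h t - (t' - t)^-1 *: (h ((t' - t) *: 1 + t) - h t)| <= e.
  have c : t' - t @[t' --> t] --> 0.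
    by rewrite -(subrr t); apply: cvgB; [exact: cvg_id|exact: cvg_cst].
  exact: (c _ H).
apply: filterS => t' H' t't.
have := H' _; rewrite subr_eq0 => /(_ t't).
by rewrite [_ *: 1]mulr1 subrK mulrC.
Qed.

Lemma ler_cvg_norm {T : Type} {F : set_system T} {FF : ProperFilter F}
    (u : T -> R) (l C : R) :
  (\forall x \near F, `|u x| <= C) -> u @ F --> l -> `|l| <= C.
Proof.
by move=> uC /cvg_norm ul; apply: (cvgr_to_le ul).
Qed.

Lemma bounded_integrable_itv (r : R -> R) (C x y : R) :
  measurable_fun setT r -> (forall t, `|r t| <= C) ->
  leb.-integrable `]x, y] (EFin \o r).
Proof.
move=> mr rC; apply: measurable_bounded_integrable.
- exact: measurable_itv.
- rewrite /= lebesgue_measure_itv/=; case: ifP => // _.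
  by rewrite -EFinB ltry.
- exact: measurable_funTS.
- exists C; split; first exact: num_real.
  by move=> D CD t _ /=; rewrite (le_trans (rC t))// ltW.
Qed.

(** Adding C x makes h monotone. The density is truncated to [-C, C], which
    changes it on a null set only, so that the bound holds at every point; this
    keeps suprema of countably many densities finite. *)
Lemma lipschitz_density (h : R -> R) (C M : R) :
  (forall x y, `|h x - h y| <= C * `|x - y|) ->
  exists2 r : R -> R, measurable_fun setT r /\ (forall t, `|r t| <= C) &
    (forall x y, - M <= x -> x <= y -> y <= M ->
      h y - h x = \int[leb]_(t in `]x, y]) r t) /\
    {ae leb, forall t, - M < t -> t < M -> is_derive t 1 h (r t)}.
Proof.
move=> hC.
have C0 : 0 <= C.
  by have := hC 1 0; rewrite subr0 normr1 mulr1; apply: le_trans.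
pose g x := h x + C * x.
have hcont : continuous h.
  move=> x; apply/cvgrPdist_le => e e0; near=> y.
  rewrite (le_trans (hC _ _))// (@le_trans _ _ ((C + 1) * `|x - y|))//.
    by rewrite ler_wpM2r// lerDl.
  rewrite -ler_pdivlMl ?ltr_wpDl//; near: y.
  by apply: cvgr_dist_le => //; rewrite mulr_gt0// invr_gt0 ltr_wpDl.
have ndg : nondecreasing g.
  move=> x y xy; rewrite /g -subr_ge0.
  have := hC x y; rewrite (ler0_norm (_ : x - y <= 0)) ?subr_le0//.
  by move=> /(le_trans (ler_norm _)); lra.
have gcont : continuous g.
  move=> x; apply: cvgD; first exact: hcont.
  by apply: cvgM; [exact: cvg_cst|exact: cvg_id].
have gC x y : x <= y -> g y - g x <= (2 * C) * (y - x).
  move=> xy; have := hC y x; rewrite (ger0_norm (_ : 0 <= y - x)) ?subr_ge0//.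
  by move=> /(le_trans (ler_norm _)); rewrite /g; lra.
have [f fint [fE fD]] := @monotone_lipschitz_density R g (2 * C) M ndg gcont gC.
have mf : measurable_fun setT f by apply/measurable_EFinP; exact: measurable_int fint.
pose r t := Num.max (- C) (Num.min C (f t - C)).
have rC t : `|r t| <= C.
  rewrite ler_norml /r le_max lexx/= ge_max ge_min lexx/= andbT.
  by apply: (le_trans _ C0); rewrite oppr_le0.
have hder : {ae leb, forall t, - M < t -> t < M ->
    is_derive t 1 h (f t - C) /\ r t = f t - C}.
  move: fD; apply: filterS; first exact: (ae_filter_ringOfSetsType leb).
  move=> t + Mt tM => /(_ Mt tM) gD.
  have hD : is_derive t 1 h (f t - C).
    have -> : h = g - (fun x => C * x) by apply/funext => x; rewrite !fctE /g addrK.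
    apply: is_deriveB.
    have -> : (fun x => C * x) = C \*: (@id R : R -> R^o) by [].
    by rewrite -[X in is_derive _ _ _ X](mulr1 C); apply: is_deriveZ.
  split=> //.
  have fC : `|f t - C| <= C.
    apply: ler_cvg_norm (is_derive_quotient hD).
    near=> s; rewrite normrM normfV ler_pdivrMr ?hC// normr_gt0 subr_eq0.
    by near: s; exact: nbhs_dnbhs_neq.
  move: fC; rewrite ler_norml => /andP[fC1 fC2].
  by rewrite /r (min_idPr fC2) (max_idPr fC1).
have mr : measurable_fun setT r.
  apply: measurable_maxr; first exact: measurable_cst.
  apply: measurable_minr; first exact: measurable_cst.
  by apply: measurable_funB => //; exact: measurable_cst.
exists r; first by split.
split; last first.
  move: hder; apply: filterS; first exact: (ae_filter_ringOfSetsType leb).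
  by move=> t + Mt tM => /(_ Mt tM)[+ ->].
move=> x y Mx xy yM.
have -> : h y - h x = g y - g x - C * (y - x) by rewrite /g; ring.
rewrite fE//.
have ifxy : leb.-integrable `]x, y] (EFin \o f).
  by apply: integrableS fint => //; exact: measurable_itv.
have ic : leb.-integrable `]x, y] (EFin \o cst C).
  apply: (@bounded_integrable_itv _ `|C|) => //; exact: measurable_cst.
have -> : C * (y - x) = \int[leb]_(t in `]x, y]) cst C t.
  rewrite Rintegral_cst//.
  congr (_ * _); rewrite /= lebesgue_measure_itv/= lte_fin.
  by case: ltP => //=; lra.
rewrite -RintegralB//.
rewrite /Rintegral; congr fine; apply: ae_eq_integral => //.
- apply/measurable_EFinP/measurable_funTS/measurable_funB => //.
- exact/measurable_EFinP/measurable_funTS.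
(* The derivative of h is known in the open interval only; the endpoint y = M is
   discarded as a null set. *)
have aeM : {ae leb, forall t, t != M}.
  exists [set M]; split; [exact: (@measurable_set1 R M)|exact: lebesgue_measure_set1|].
  by move=> t /= /negP; rewrite negbK => /eqP.
move: hder aeM; apply: filterS2; first exact: (ae_filter_ringOfSetsType leb).
move=> t hder tM; rewrite /= in_itv/= => /andP[xt ty]; congr EFin.
by have [|| _ ->] := hder; rewrite ?(le_lt_trans Mx)// lt_neqAle tM (le_trans ty).
Unshelve. all: by end_near. Qed.

End LipschitzDensity.

Section Extension.
Context {R : realType}.

(** McShane's formula: the extension is the infimum of the cones
    x |-> u s + C |x - s| with vertex over K. *)
Lemma lipschitz_extension (K : set R) (u : R -> R) (C : R) :
  0 <= C -> (forall s t, K s -> K t -> `|u s - u t| <= C * `|s - t|) ->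
  exists2 h : R -> R, (forall s, K s -> h s = u s) &
    forall x y, `|h x - h y| <= C * `|x - y|.
Proof.
move=> C0 uC; have [[s0 Ks0]|] := pselect (K !=set0); last first.
  move=> K0; exists (cst 0).
    by move=> s Ks; exfalso; apply: K0; exists s.
  by move=> x y; rewrite subrr normr0 mulr_ge0.
pose E x := [set u s + C * `|x - s| | s in K].
have E0 x : E x !=set0 by exists (u s0 + C * `|x - s0|); exists s0.
have lE x : lbound (E x) (u s0 - C * `|x - s0|).
  move=> _ [s Ks <-]; have := uC _ _ Ks0 Ks.
  move=> /(le_trans (ler_norm _)).
  have := ler_distD x s0 s; rewrite (distrC s0 x) => /(ler_wpM2l C0).
  by rewrite mulrDr; lra.
have hE x : has_inf (E x) by split; [exact: E0|exists (u s0 - C * `|x - s0|)].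
have half x y : inf (E x) - inf (E y) <= C * `|x - y|.
  apply/ler_addgt0Pr => e e0; have [_ [s Ks <-] Es] := inf_adherent e0 (hE y).
  have : inf (E x) <= u s + C * `|x - s|.
    by apply: ge_inf; [exact: (hE x).2|exists s].
  have := ler_distD y x s => /(ler_wpM2l C0); rewrite mulrDr => H1 H2.
  by move: Es H1 H2; lra.
exists (fun x => inf (E x)).
- move=> s Ks; apply/eqP; rewrite eq_le; apply/andP; split.
    apply: ge_inf; first exact: (hE s).2.
    by exists s => //; rewrite subrr normr0 mulr0 addr0.
  apply: lb_le_inf => // _ [t Kt <-].
  by have := uC _ _ Ks Kt => /(le_trans (ler_norm _)); lra.
- by move=> x y; rewrite ler_norml half andbT lerNl opprB distrC half.
Qed.

(** A point of K is chosen in every interval with rational centre and radius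
    1/(k+1) that meets K. *)
Lemma dense_sequence (K : set R) : K !=set0 ->
  exists2 z : nat -> R, (forall n, K (z n)) &
    forall s (e : R), K s -> 0 < e -> exists n, `|s - z n| < e.
Proof.
move=> [s0 Ks0].
have H (p : option (rat * nat)) : exists x : R, K x /\
    forall a k, p = Some (a, k) -> (exists2 s, K s & `|s - ratr a| < k.+1%:R^-1) ->
      `|x - ratr a| < k.+1%:R^-1.
  case: p => [[a k]|]; last by exists s0.
  have [[s Ks sa]|ns] := pselect (exists2 s, K s & `|s - ratr a| < k.+1%:R^-1).
    by exists s; split => // a' k' [<- <-].
  by exists s0; split => // a' k' [<- <-].
have [z Hz] := choice H.
exists (fun n => z (unpickle n)); first by move=> n; have [] := Hz (unpickle n).
move=> s e Ks e0.
have [k ke] : exists k : nat, 0 + k.+1%:R^-1 < e / 2.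
  by apply: ltr_add_invr; rewrite divr_gt0.
rewrite add0r in ke.
have k0 : (0 : R) < k.+1%:R^-1 by rewrite invr_gt0.
have [a] := @rat_in_itvoo R (s - k.+1%:R^-1) s (ltac:(by rewrite ltrBlDr ltrDl)).
rewrite in_itv/= => /andP[sa1 sa2].
have sa : `|s - ratr a| < k.+1%:R^-1.
  have s_ge : 0 <= s - ratr a by rewrite subr_ge0 ltW.
  by rewrite ger0_norm// ltrBlDr -ltrBlDl.
exists (pickle (a, k)); rewrite pickleK.
have [_ /(_ a k erefl)] := Hz (Some (a, k)).
have Ksa : exists2 s, K s & `|s - ratr a| < k.+1%:R^-1 by exists s.
move=> /(_ Ksa) za.
rewrite (le_lt_trans (ler_distD (ratr a) _ _))// (distrC (ratr a)).
by rewrite (splitr e) ltrD// (lt_trans _ ke).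
Qed.

End Extension.

(** * Metric differential of a Lipschitz curve *)

Section MetricDifferential.
Context {R : realType} {X : metricType R}.
Local Notation leb := (@lebesgue_measure R).

(** With u_i = d(gamma, z_i) for z_i dense in the curve, d(gamma s, gamma t) is
    the supremum of |u_i s - u_i t|. Put m = sup_i |u_i'|. Each single u_i
    bounds the quotient from below by values close to |u_i'|, hence to m; the
    integral of m bounds the distance from above, and by Lebesgue's theorem its
    quotients tend to m. *)
Lemma metric_differential (K : set R) (M C : R) (gamma : R -> X) :
  K `<=` `]- M, M[ -> 0 <= C ->
  (forall s t, K s -> K t -> mdist (gamma s) (gamma t) <= C * `|s - t|) ->
  exists m : R -> R, {ae leb, forall t, K t ->
    mdist (gamma t') (gamma t) / `|t' - t| @[t' --> within K t^'] --> m t}.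
Proof.
move=> KM C0 gC; have [K0|] := pselect (K !=set0); last first.
  by move=> K0; exists (cst 0); apply: aeW => t Kt; exfalso; apply: K0; exists t.
have [z Kz zdense] := dense_sequence K0.
pose u i s := mdist (gamma s) (gamma (z i)).
have u_dist i s t : `|u i s - u i t| <= mdist (gamma s) (gamma t).
  rewrite ler_norml lerBrDr lerBlDr /u; apply/andP; split.
    rewrite addrC lerBlDr addrC (metric_sym (gamma s) (gamma t)).
    exact: metric_triangle.
  exact: metric_triangle.
have ext i : exists hr : (R -> R) * (R -> R),
    [/\ forall s, K s -> hr.1 s = u i s,
        measurable_fun setT hr.2, (forall t, `|hr.2 t| <= C),
        (forall x y, - M <= x -> x <= y -> y <= M ->
          hr.1 y - hr.1 x = \int[leb]_(t in `]x, y]) hr.2 t) &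
        {ae leb, forall t, - M < t -> t < M -> is_derive t 1 hr.1 (hr.2 t)}].
  have [|h hu hC] := @lipschitz_extension R K (u i) C C0.
    by move=> s t Ks Kt; rewrite (le_trans (u_dist _ _ _))// gC.
  by have [r [mr rC] [rint rder]] := @lipschitz_density R h C M hC; exists (h, r).
have [hr Hhr] := choice ext.
pose h i := (hr i).1; pose r i := (hr i).2.
pose m t := sups (fun i => `|r i t|) 0.
have rbd t : has_ubound (range (fun i => `|r i t|)).
  by exists C => _ [i _ <-]; have [_ _ + _ _] := Hhr i; apply.
have mE t : m t = sup (range (fun i => `|r i t|)).
  rewrite /m/= /sdrop; congr sup; apply/seteqP; split => [_ [i _ <-]|_ [i _ <-]];
  by exists i.
have r_le i t : `|r i t| <= m t by rewrite mE; apply: ub_le_sup => //; exists i.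
have m_le t : m t <= C.
  rewrite mE; apply: ge_sup; first by exists `|r 0%N t|; exists 0%N.
  by move=> _ [i _ <-]; have [_ _ + _ _] := Hhr i; apply.
have m0 t : 0 <= m t by exact: le_trans (normr_ge0 (r 0%N t)) (r_le _ _).
have mm : measurable_fun setT m.
  apply: (@measurable_fun_sups _ _ _ _ (fun i t => `|r i t|)) => // i.
  by apply: measurableT_comp => //; have [] := Hhr i.
pose D : set R := `]- M, M]%classic.
(* Cutting off outside ]-M, M] makes m integrable. *)
pose f := m \_ D.
have mf : measurable_fun setT f.
  apply/(measurable_restrictT _ _).1; first exact: measurable_itv.
  exact: measurable_funTS.
have f0 t : 0 <= f t by rewrite /f patchE; case: ifP.
have fC t : `|f t| <= C.
  by rewrite ger0_norm// /f patchE; case: ifP.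
have fE t : - M < t -> t <= M -> f t = m t.
  by move=> Mt tM; rewrite /f patchE mem_set// /D/= in_itv/= Mt tM.
have fint x y : leb.-integrable `]x, y] (EFin \o f).
  exact: bounded_integrable_itv mf fC.
have locf : locally_integrable setT f.
  apply: integrable_locally_restrict; first exact: measurable_itv.
  apply: (@bounded_integrable_itv _ _ C) => // t.
  by rewrite ger0_norm.
pose H x := \int[leb]_(t in `]- M, x]) f t.
have HB x y : - M <= x -> x <= y -> H y - H x = \int[leb]_(t in `]x, y]) f t.
  by move=> Mx xy; rewrite /H Rintegral_itvB.
(* The upper bound: u_i with z_i near gamma s sees the distance from gamma s to
   gamma t up to an arbitrarily small error. *)
have mdistH s t : K s -> K t -> s <= t -> mdist (gamma t) (gamma s) <= H t - H s.
  move=> Ks Kt st; apply/ler_addgt0Pr => e e0.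
  have e1 : 0 < e / (2 * (C + 1)) by rewrite divr_gt0// mulr_gt0// ltr_wpDl.
  have [i zi] := zdense s _ Ks e1.
  have /andP[Ms sM] : - M < s < M by have /= := KM _ Ks; rewrite in_itv.
  have /andP[Mt tM] : - M < t < M by have /= := KM _ Kt; rewrite in_itv.
  have [hE mr rC hint _] := Hhr i.
  have : u i t - u i s <= H t - H s.
    rewrite -!hE// hint ?(ltW Ms) ?(ltW tM)// HB ?(ltW Ms)//.
    apply: le_Rintegral.
    - exact: measurable_itv.
    - exact: bounded_integrable_itv mr rC.
    - exact: fint.
    - move=> x; rewrite /= in_itv/= => /andP[sx xt].
      rewrite fE ?(lt_trans Ms)// ?(le_trans xt (ltW tM))//.
      by rewrite (le_trans (ler_norm _))// r_le.
  have : mdist (gamma s) (gamma (z i)) <= e / 2.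
    rewrite (le_trans (gC _ _ Ks (Kz i)))//.
    apply: (@le_trans _ _ (C * (e / (2 * (C + 1))))).
      by rewrite ler_wpM2l// ltW.
    have C1 : 0 < C + 1 by rewrite ltr_wpDl.
    rewrite mulrA ler_pdivrMr ?mulr_gt0//.
    have -> : e / 2 * (2 * (C + 1)) = C * e + e by field.
    by rewrite lerDl ltW.
  have := metric_triangle (gamma t) (gamma (z i)) (gamma s).
  by rewrite /u (metric_sym (gamma (z i))); lra.
have mdist_normH s t : K s -> K t -> mdist (gamma t) (gamma s) <= `|H t - H s|.
  move=> Ks Kt; have [st|/ltW ts] := leP s t.
    by rewrite (le_trans _ (ler_norm _))// mdistH.
  by rewrite metric_sym distrC (le_trans _ (ler_norm _))// mdistH.
exists m.
have derH : {ae leb, forall t, - M < t -> t < M -> is_derive t 1 H (m t)}.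
  have := @FTC1 R f (BRight (- M)) (fint _) locf.
  apply: filterS; first exact: (ae_filter_ringOfSetsType leb).
  move=> t FTCt Mt tM; have [//|dF F't] := FTCt _.
  by apply: (DeriveDef dF); rewrite -derive1E -(fE _ Mt (ltW tM)); exact: F't.
have derh : {ae leb, forall t, forall i, - M < t -> t < M ->
    is_derive t 1 (h i) (r i t)}.
  by apply: ae_foralln => i; have [_ _ _ _] := Hhr i.
move: derH derh; apply: filterS2; first exact: (ae_filter_ringOfSetsType leb).
move=> t derH derh Kt.
have /andP[Mt tM] : - M < t < M by have /= := KM _ Kt; rewrite in_itv.
apply/cvgrPdist_le => e e0.
have /cvgrPdist_le/(_ e e0) nH :
    `|(H t' - H t) / (t' - t)| @[t' --> t^'] --> `|m t|.
  by apply: cvg_norm; exact: is_derive_quotient (derH Mt tM).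
have e2 : 0 < e / 2 by rewrite divr_gt0.
have [_ [i _ <-] mi] : exists2 x, range (fun i => `|r i t|) x & m t - e / 2 < x.
  rewrite mE; apply: sup_adherent => //; split => //.
  by exists `|r 0%N t|; exists 0%N.
have /cvgrPdist_le/(_ _ e2) nh :
    `|(h i t' - h i t) / (t' - t)| @[t' --> t^'] --> `|r i t|.
  by apply: cvg_norm; exact: is_derive_quotient (derh i Mt tM).
rewrite near_withinE; move: nH nh; apply: filterS2 => t'.
rewrite (ger0_norm (m0 t)) !normrM !normfV => nH nh Kt'.
have [hE _ _ _ _] := Hhr i.
have up : mdist (gamma t') (gamma t) / `|t' - t| <= `|H t' - H t| / `|t' - t|.
  by rewrite ler_wpM2r ?invr_ge0// mdist_normH.
have lo : `|h i t' - h i t| / `|t' - t| <= mdist (gamma t') (gamma t) / `|t' - t|.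
  by rewrite ler_wpM2r ?invr_ge0// /h !hE// u_dist.
move: nH nh up lo mi; rewrite !ler_norml => /andP[? ?] /andP[? ?] ? ? ?.
by apply/andP; split; lra.
Qed.

End MetricDifferential.

Section Accumulation.
Context {R : realType}.
Local Notation leb := (@lebesgue_measure R).

(** At an isolated point the density of K is 0, whereas it is 1 at almost every
    point of K. This makes the limits along K meaningful. *)
Lemma ae_limit_point (K : set R) : measurable K ->
  {ae leb, forall t, K t -> limit_point K t}.
Proof.
move=> mK; have := lebesgue_density mK.
apply: filterS; first exact: (ae_filter_ringOfSetsType leb).
move=> t dens Kt; apply: contrapT; rewrite not_limit_pointE => -[V Vt KV].
have : (leb (K `&` ball t r) * (leb (ball t r))^-1)%E @[r --> 0^'+] --> 0%E.
  have [e /= e0 eV] : nbhs_ball t V by rewrite nbhs_ballE.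
  apply: cvg_near_cst; near=> r.
  have -> : leb (K `&` ball t r) = 0%E; last by rewrite mul0e.
  apply/eqP; rewrite eq_le measure_ge0 andbT -(lebesgue_measure_set1 t).
  apply: le_measure; rewrite ?inE.
  - by apply: measurableI => //; exact: measurable_ball.
  - exact: measurable_set1.
  - move=> s [Ks ts]; apply: KV; split => //; apply: eV.
    by apply: le_ball ts; near: r; exact: nbhs_right_le.
move=> /(cvg_unique _ dens); rewrite indicE mem_set// => /(_ (@ereal_hausdorff R)).
by move/eqP; rewrite eqe oner_eq0.
Unshelve. all: by end_near. Qed.

Lemma within_limit_point (K : set R) (t : R) : limit_point K t ->
  ProperFilter (within K t^').
Proof.
move=> lKt; apply: Build_ProperFilter; rewrite /within/= => H.
have [//|y [yt Ky]] := lKt [set y | y != t -> ~ K y] _.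
by apply.
Qed.

End Accumulation.


(** * Euclidean geometry and the cone distance *)

Section EuclideanTheory.
Context {R : realType} {q : nat}.
Implicit Types (u v w : 'rV[R]_q) (a : R).

Lemma dotpC u v : dotp u v = dotp v u.
Proof. by apply: eq_bigr => i _; rewrite mulrC. Qed.

Lemma dotpDr u v w : dotp u (v + w) = dotp u v + dotp u w.
Proof. by rewrite /dotp -big_split; apply: eq_bigr => i _; rewrite mxE mulrDr. Qed.

Lemma dotpZr a u v : dotp u (a *: v) = a * dotp u v.
Proof. by rewrite /dotp mulr_sumr; apply: eq_bigr => i _; rewrite mxE mulrCA. Qed.

Lemma dotpNr u v : dotp u (- v) = - dotp u v.
Proof. by rewrite -scaleN1r dotpZr mulN1r. Qed.

Lemma dotpBr u v w : dotp u (v - w) = dotp u v - dotp u w.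
Proof. by rewrite dotpDr dotpNr. Qed.

Lemma dotpBl u v w : dotp (v - w) u = dotp v u - dotp w u.
Proof. by rewrite ![dotp _ u]dotpC dotpBr. Qed.

Lemma dotpZl a u v : dotp (a *: u) v = a * dotp u v.
Proof. by rewrite dotpC dotpZr dotpC. Qed.

Lemma dotp_ge0 u : 0 <= dotp u u.
Proof. by apply: sumr_ge0 => i _; rewrite -expr2 sqr_ge0. Qed.

Lemma norm2_ge0 u : 0 <= norm2 u.
Proof. exact: sqrtr_ge0. Qed.

Lemma norm2_sqr u : norm2 u ^+ 2 = dotp u u.
Proof. by rewrite sqr_sqrtr// dotp_ge0. Qed.

Lemma norm2Z a u : norm2 (a *: u) = `|a| * norm2 u.
Proof. by rewrite /norm2 dotpZr dotpZl mulrA -expr2 sqrtrM ?sqr_ge0// sqrtr_sqr. Qed.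

Lemma norm2N u : norm2 (- u) = norm2 u.
Proof. by rewrite -scaleN1r norm2Z normrN1 mul1r. Qed.

Lemma cauchy_schwarz u v : dotp u v <= norm2 u * norm2 v.
Proof.
have [v0|v0] := eqVneq (dotp v v) 0.
  have -> : dotp u v = 0; last by rewrite mulr_ge0// norm2_ge0.
  apply: big1 => i _; suff -> : v 0 i = 0 by rewrite mulr0.
  apply/eqP; rewrite -sqrf_eq0 expr2; apply/eqP.
  move: v0 => /psumr_eq0P; apply => // j _.
  by rewrite -expr2 sqr_ge0.
have vgt0 : 0 < dotp v v by rewrite lt_def v0 dotp_ge0.
have := dotp_ge0 (dotp v v *: u - dotp u v *: v).
rewrite dotpBr !dotpBl !dotpZl !dotpZr (dotpC v u).
have -> : dotp v v * (dotp v v * dotp u u) - dotp u v * (dotp v v * dotp u v) -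
    (dotp v v * (dotp u v * dotp u v) - dotp u v * (dotp u v * dotp v v)) =
    dotp v v * (dotp u u * dotp v v - dotp u v ^+ 2) by ring.
rewrite pmulr_rge0// subr_ge0 -!norm2_sqr -exprMn => H.
have [uv|/ltW uv] := leP 0 (dotp u v).
  by rewrite -(@ler_pXn2r _ 2)// nnegrE ?mulr_ge0 ?norm2_ge0.
by rewrite (le_trans uv)// mulr_ge0 ?norm2_ge0.
Qed.

Lemma norm2D u v : norm2 (u + v) <= norm2 u + norm2 v.
Proof.
rewrite -(@ler_pXn2r _ 2)// ?nnegrE ?addr_ge0 ?norm2_ge0//.
rewrite norm2_sqr sqrrD !norm2_sqr !dotpDr ![dotp (u + v) _]dotpC !dotpDr (dotpC v u).
by have := cauchy_schwarz u v; lra.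
Qed.

Lemma norm2B u v : norm2 (u - v) = norm2 (v - u).
Proof. by rewrite -norm2N opprB. Qed.

Lemma proj_perpB w u v : proj_perp w u - proj_perp w v = proj_perp w (u - v).
Proof.
rewrite /proj_perp dotpBr mulrBl scalerBl.
by rewrite !opprB [LHS]addrACA [RHS]addrACA [- v - _]addrC.
Qed.

Lemma proj_perpZ w a u : proj_perp w (a *: u) = a *: proj_perp w u.
Proof. by rewrite /proj_perp dotpZr scalerBr scalerA mulrA. Qed.

Section unit_vector.
Variables (w : 'rV[R]_q).
Hypothesis w1 : norm2 w = 1.

Lemma norm_dotp_le u : `|dotp w u| <= norm2 u.
Proof.
rewrite ler_norml lerNl -dotpNr; apply/andP; split.
  by rewrite (le_trans (cauchy_schwarz _ _))// w1 mul1r norm2N.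
by rewrite (le_trans (cauchy_schwarz _ _))// w1 mul1r.
Qed.

Lemma norm2_proj_perp_le u : norm2 (proj_perp w u) <= norm2 u.
Proof.
rewrite -(@ler_pXn2r _ 2)// ?nnegrE ?norm2_ge0// !norm2_sqr /proj_perp.
have ww : dotp w w = 1 by rewrite -norm2_sqr w1 expr1n.
rewrite ww divr1 dotpBr !dotpBl !dotpZr !dotpZl ww (dotpC u w).
by have := sqr_ge0 (dotp w u); rewrite expr2; lra.
Qed.

End unit_vector.
End EuclideanTheory.

Section ConeDistance.
Context {R : realType} {X : metricType R} {q : nat}.
Variables (f : X -> 'rV[R]_q) (L delta : R) (w : 'rV[R]_q) (alpha : R).
Hypothesis lipf : lipschitz2 f L.
Hypothesis delta_gt0 : 0 < delta.
Hypothesis w1 : norm2 w = 1.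
Hypothesis cot_gt0 : 0 < cot alpha.
Local Notation D := (dist_cone f delta w alpha).
Local Notation F := (fun x => dotp w (f x)).

Lemma height_lipschitz x y : `|F x - F y| <= L * mdist x y.
Proof. by rewrite -dotpBr (le_trans (norm_dotp_le w1 _))// lipf. Qed.

Lemma dist_cone_sym x y : D x y = D y x.
Proof. by rewrite /dist_cone metric_sym norm2B. Qed.

Lemma dist_cone_triangle y x z : D x z <= D x y + D y z.
Proof.
rewrite /dist_cone addrACA -!mulrDr lerD//.
  by rewrite (ler_wpM2l (ltW delta_gt0))// metric_triangle.
rewrite (ler_wpM2l (ltW cot_gt0))//; apply: le_trans (norm2D _ _).
rewrite le_eqVlt; apply/orP; left; apply/eqP.
by congr norm2; rewrite addrA subrK.
Qed.

Lemma mdist_le_dist_cone x y : delta * mdist x y <= D x y.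
Proof. by rewrite lerDl mulr_ge0 ?norm2_ge0// ltW. Qed.

Lemma dist_cone_ge0 x y : 0 <= D x y.
Proof.
by rewrite (le_trans _ (mdist_le_dist_cone _ _))// mulr_ge0 ?mdist_ge0// ltW.
Qed.

Lemma dist_conexx x : D x x = 0.
Proof.
rewrite /dist_cone mdistxx mulr0 subrr add0r.
have -> : norm2 (0 : 'rV[R]_q) = 0; last by rewrite mulr0.
by rewrite -(scale0r 0) norm2Z normr0 mul0r.
Qed.

Lemma dist_cone_le_mdist x y : D x y <= (delta + cot alpha * L) * mdist x y.
Proof.
rewrite /dist_cone mulrDl lerD2l -mulrA (ler_wpM2l (ltW cot_gt0))// proj_perpB.
by rewrite (le_trans (norm2_proj_perp_le w1 _))// lipf.
Qed.

End ConeDistance.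

Section RowVectors.
Context {R : realType} {q : nat}.
Implicit Types u : 'rV[R]_q.

Lemma cvg_row {T : Type} {F : set_system T} {FF : Filter F}
    (u : T -> 'rV[R]_q) (l : 'rV[R]_q) :
  (forall i, u x 0 i @[x --> F] --> l 0 i) -> u x @[x --> F] --> l.
Proof.
move=> ul; apply/cvg_ballP => e e0.
have : \forall x \near F, forall i, ball (l 0 i) e (u x 0 i).
  by apply: filter_forall => i; have /cvg_ballP/(_ e e0) := ul i.
by apply: filterS => x ux; split=> // i j; rewrite ord1.
Qed.

Lemma cvg_dotp {T : Type} {F : set_system T} {FF : Filter F}
    (u v : T -> 'rV[R]_q) (a b : 'rV[R]_q) :
  (forall i, u x 0 i @[x --> F] --> a 0 i) ->
  (forall i, v x 0 i @[x --> F] --> b 0 i) ->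
  dotp (u x) (v x) @[x --> F] --> dotp a b.
Proof.
move=> ua vb; rewrite /dotp.
by apply: cvg_big => [|i _]; [exact: add_continuous|exact: cvgM].
Qed.

Lemma dotp_proj_perp (w u : 'rV[R]_q) : norm2 w = 1 ->
  dotp (proj_perp w u) (proj_perp w u) = dotp u u - dotp w u ^+ 2.
Proof.
move=> w1; have ww : dotp w w = 1 by rewrite -norm2_sqr w1 expr1n.
rewrite /proj_perp ww divr1 dotpBr !dotpBl !dotpZr !dotpZl ww (dotpC u w).
by ring.
Qed.

End RowVectors.

(** * Fragments carried by totally ordered sets *)

Section ChainFragment.
Context {R : realType} {X : metricType R} {q : nat}.
Variables (f : X -> 'rV[R]_q) (L delta : R) (w : 'rV[R]_q) (alpha : R).
Hypothesis lipf : lipschitz2 f L.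
Hypothesis delta_gt0 : 0 < delta.
Hypothesis w1 : norm2 w = 1.
Hypothesis cot_gt0 : 0 < cot alpha.
Hypothesis tan_cot : tan alpha * cot alpha = 1.
Local Notation leb := (@lebesgue_measure R).
Local Notation D := (dist_cone f delta w alpha).
Local Notation F := (fun x => dotp w (f x)).
Variable G : set X.
Hypothesis cptG : compact G.
Hypothesis chainG : forall p p', G p -> G p' -> D p p' <= `|F p - F p'|.
Hypothesis height_gt0 : (0 < leb (F @` G))%E.

Lemma height_continuous : continuous F.
Proof.
move=> x; apply/cvgrPdist_le => e e0.
have L1 : 0 < `|L| + 1 by rewrite ltr_wpDl.
have : nbhs x (ball x (e / (`|L| + 1))) by apply: nbhsx_ballx; rewrite divr_gt0.
apply: filterS => y; rewrite ballEmdist/= => xy.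
rewrite (le_trans (height_lipschitz lipf w1 _ _))//.
rewrite (@le_trans _ _ ((`|L| + 1) * mdist x y))//.
  by rewrite ler_wpM2r ?mdist_ge0// (le_trans (ler_norm _))// lerDl.
by rewrite mulrC -ler_pdivlMr// ltW.
Qed.

Let K := F @` G.

Let cptK : compact K.
Proof. by apply: continuous_compact => //; exact/continuous_subspaceT/height_continuous. Qed.

(** F is injective on G because D separates points. *)
Lemma chain_inverse : exists gamma : R -> X,
  [/\ forall t, K t -> G (gamma t), forall t, K t -> F (gamma t) = t &
      gamma @` K = G].
Proof.
have [t0 [p0 Gp0 _]] : K !=set0.
  by apply/set0P; apply: contraTN height_gt0 => /eqP; rewrite -/K => ->; rewrite measure0 ltxx.
have H t : exists p, K t -> G p /\ F p = t.
  have [[p Gp <-]|nK] := pselect (K t); first by exists p.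
  by exists p0 => /nK.
have [gamma Hg] := choice H.
exists gamma; split; [by move=> t /Hg[]|by move=> t /Hg[]|].
apply/seteqP; split=> [_ [t /Hg[Gg _] <-]//|p Gp].
have KFp : K (F p) by exists p.
exists (F p) => //; have [Gg Fg] := Hg _ KFp.
apply: mdist_positivity; apply/eqP; rewrite eq_le mdist_ge0 andbT.
rewrite -(ler_pM2l delta_gt0) mulr0.
have := chainG Gg Gp; rewrite /= Fg subrr normr0; apply: le_trans.
exact: mdist_le_dist_cone.
Qed.

(** The chain condition bounds d from above by the height difference, and F is
    Lipschitz, so the inverse of F is bi-Lipschitz. In D p p' <= |F p - F p'|
    the term delta d is at least (delta / C) |F p - F p'|, where C is the
    bi-Lipschitz constant: this leaves room for the strict inequality that
    defines the open cone. *)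
Lemma chain_fragment : exists2 gamma : fragment X,
  Frag f delta w alpha gamma & gamma @` fdom gamma = G.
Proof.
have [g [gG Fg gK]] := chain_inverse.
pose C : R := Num.max (`|L| + 1) delta^-1.
have C0 : 0 < C by rewrite lt_max ltr_wpDl.
have g_cone s t : K s -> K t -> D (g s) (g t) <= `|s - t|.
  move=> Ks Kt; rewrite -{2}(Fg _ Ks) -{2}(Fg _ Kt).
  by apply: chainG; exact: gG.
have g_up s t : K s -> K t -> mdist (g s) (g t) <= delta^-1 * `|s - t|.
  move=> Ks Kt; rewrite ler_pdivlMl//.
  by rewrite (le_trans _ (g_cone _ _ Ks Kt))// mdist_le_dist_cone.
have g_lo s t : K s -> K t -> C^-1 * `|s - t| <= mdist (g s) (g t).
  move=> Ks Kt; rewrite ler_pdivrMl// -{1}(Fg _ Ks) -{1}(Fg _ Kt).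
  rewrite (le_trans (height_lipschitz lipf w1 _ _))// ler_wpM2r ?mdist_ge0//.
  by rewrite le_max (le_trans (ler_norm _))// lerDl.
have bilip : exists2 C : R, 0 < C & forall s t, K s -> K t ->
    C^-1 * `|s - t| <= mdist (g s) (g t) <= C * `|s - t|.
  exists C => // s t Ks Kt; rewrite g_lo//= (le_trans (g_up _ _ Ks Kt))//.
  by rewrite ler_wpM2r// le_max lexx orbT.
exists (Fragment cptK height_gt0 bilip) => //.
rewrite /Frag/=.
have [M KM] : exists M, K `<=` `]- M, M[.
  have [M0 [_ KM]] := compact_bounded cptK.
  exists (M0 + 2) => t Kt; rewrite /= in_itv/= -ltr_norml.
  by rewrite (le_lt_trans (KM (M0 + 1) _ _ Kt))// ?ltrD2l ?ltrDl// ltr1n.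
have dgt0 : 0 <= delta^-1 by rewrite invr_ge0 ltW.
have [m md_m] := metric_differential KM dgt0 g_up.
have Ldgt0 : 0 <= `|L| * delta^-1 by rewrite mulr_ge0.
have coord i : exists hr : (R -> R) * (R -> R),
    (forall s, K s -> hr.1 s = f (g s) 0 i) /\
    {ae leb, forall t, - M < t -> t < M -> is_derive t 1 hr.1 (hr.2 t)}.
  have [|h hu hC] := @lipschitz_extension R K (fun s => f (g s) 0 i) _ Ldgt0.
    move=> s t Ks Kt; rewrite -mulrA.
    apply: (@le_trans _ _ (`|L| * mdist (g s) (g t))); last first.
      by rewrite ler_wpM2l// g_up.
    apply: (@le_trans _ _ (L * mdist (g s) (g t))); last first.
      by rewrite ler_wpM2r ?mdist_ge0// ler_norm.
    apply: le_trans (lipf _ _); set u := f (g s) - f (g t).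
    have -> : f (g s) 0 i - f (g t) 0 i = u 0 i by rewrite !mxE.
    rewrite -(@ler_pXn2r _ 2)// ?nnegrE ?norm2_ge0// norm2_sqr real_normK ?num_real//.
    rewrite /dotp (bigD1 i)//= expr2 lerDl; apply: sumr_ge0 => j _.
    by rewrite -expr2 sqr_ge0.
  by have [r _ [_ rder]] := lipschitz_density M hC; exists (h, r).
have [hr Hhr] := choice coord.
have ders : {ae leb, forall t, forall n, forall i : 'I_q, i = n :> nat ->
    - M < t -> t < M -> is_derive t 1 (hr i).1 ((hr i).2 t)}.
  apply: ae_foralln => n; have [nq|qn] := ltnP n q; last first.
    by apply: aeW => t i in_; move: (ltn_ord i); rewrite in_ ltnNge qn.
  have [_] := Hhr (Ordinal nq).
  apply: filterS; first exact: (ae_filter_ringOfSetsType leb).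
  by move=> t H i in_; have -> : i = Ordinal nq by apply: val_inj.
have lims := ae_limit_point (compact_measurable cptK).
move: md_m lims ders; apply: filterS3; first exact: (ae_filter_ringOfSetsType leb).
move=> t md_m lim_t ders Kt.
have {}md_m := md_m Kt.
have FF := within_limit_point (lim_t Kt).
have /andP[Mt tM] : - M < t < M by have /= := KM _ Kt; rewrite in_itv.
pose l : 'rV[R]_q := \row_i (hr i).2 t.
have inK : \forall t' \near within K t^', K t'.
  by rewrite near_withinE; near=> s.
have neq : \forall t' \near within K t^', t' != t.
  by rewrite near_withinE; near=> s => _; near: s; exact: nbhs_dnbhs_neq.
have coord_cvg i : diff_quotient (f \o g) t t' 0 i @[t' --> within K t^'] --> l 0 i.
  have := is_derive_quotient (ders _ i erefl Mt tM); rewrite mxE => dq.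
  have : ((hr i).1 t' - (hr i).1 t) / (t' - t) @[t' --> within K t^'] --> (hr i).2 t.
    exact: cvg_within_filter.
  apply: cvg_trans; apply: near_eq_cvg; near=> s.
  have Ks : K s by near: s.
  by rewrite /diff_quotient/= !mxE !(Hhr i).1// mulrC.
have cvg_l := cvg_row coord_cvg.
have dq1 : dotp w (diff_quotient (f \o g) t t') @[t' --> within K t^'] --> (1 : R).
  apply: cvg_near_cst; near=> s.
  have Ks : K s by near: s.
  have st : s != t by near: s.
  by rewrite /diff_quotient/= dotpZr dotpBr !Fg// mulVf// subr_eq0.
have wl : dotp w l = 1.
  have : dotp w (diff_quotient (f \o g) t t') @[t' --> within K t^'] --> dotp w l.
    by apply: cvg_dotp => // i; exact: cvg_cst.
  by move=> /cvg_unique; apply; first exact: Rhausdorff.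
have md_quotientE : md_quotient (Fragment cptK height_gt0 bilip) t =
    (fun t' => mdist (g t') (g t) / `|t' - t|) by [].
(* The difference quotients lie in a fixed closed cone inside the open one. *)
have quot_cone : \forall t' \near within K t^',
    cot alpha * norm2 (proj_perp w (diff_quotient (f \o g) t t')) <= 1 - delta / C.
  near=> s; have Ks : K s by near: s.
  have st : 0 < `|s - t| by rewrite normr_gt0 subr_eq0; near: s.
  rewrite /diff_quotient/= proj_perpZ norm2Z normfV -proj_perpB mulrCA ler_pdivrMl//.
  have := g_cone s t Ks Kt; rewrite /dist_cone; have := g_lo s t Ks Kt.
  move=> /(ler_wpM2l (ltW delta_gt0)); rewrite mulrA.
  by rewrite mulrBr mulr1 [`|_| * (_ / _)]mulrC; lra.
split.
- by apply: cvgP; exact: md_m.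
- by apply: cvgP; exact: cvg_l.
- have -> : md (Fragment cptK height_gt0 bilip) t = m t.
    by apply: cvg_lim => //; exact: Rhausdorff.
  have -> : derive_in K (fun s => dotp w (f (g s)) : R^o) t = 1.
    apply: cvg_lim; first exact: Rhausdorff.
    apply: cvg_near_cst; near=> s.
    have Ks : K s by near: s.
    have st : s != t by near: s.
    by rewrite /diff_quotient/= !Fg// -[_ *: _]/(_ * _) mulVf// subr_eq0.
  rewrite -ler_pdivlMl// mulr1; apply: (cvgr_to_le md_m).
  near=> s; have Ks : K s by near: s.
  have st : 0 < `|s - t| by rewrite normr_gt0 subr_eq0; near: s.
  by rewrite ler_pdivrMr// g_up.
- have -> : derive_in K (f \o g) t = l.
    by apply: cvg_lim; [exact: norm_hausdorff|exact: cvg_l].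
  rewrite /cone/= wl mulr1.
  have dC : 0 < delta / C by rewrite divr_gt0.
  have tan_gt0 : 0 < tan alpha by rewrite -(pmulr_lgt0 _ cot_gt0) tan_cot.
  pose c := tan alpha * (1 - delta / C).
  have near_c : \forall t' \near within K t^',
      norm2 (proj_perp w (diff_quotient (f \o g) t t')) <= c.
    move: quot_cone; apply: filterS => s.
    by move=> /(ler_wpM2l (ltW tan_gt0)); rewrite mulrA tan_cot mul1r.
  have c0 : 0 <= c.
    by have [s] := filter_ex near_c; apply: le_trans; exact: norm2_ge0.
  have proj_le : norm2 (proj_perp w l) <= c.
    rewrite -(@ler_pXn2r _ 2)// ?nnegrE ?norm2_ge0// norm2_sqr dotp_proj_perp//.
    (* The squared norm of the projection is a polynomial in the coordinates,
       so coordinatewise convergence is enough. *)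
    have cvg_proj :
        dotp (diff_quotient (f \o g) t t') (diff_quotient (f \o g) t t') -
        dotp w (diff_quotient (f \o g) t t') ^+ 2 @[t' --> within K t^'] -->
        dotp l l - dotp w l ^+ 2.
      apply: cvgB; first exact: cvg_dotp.
      by rewrite wl; apply: cvgM.
    apply: (cvgr_to_le cvg_proj); near=> s.
    rewrite -dotp_proj_perp// -norm2_sqr ler_pXn2r ?nnegrE ?norm2_ge0//.
    by near: s.
  rewrite (le_lt_trans proj_le)// /c mulrBr mulr1 ltrBlDr ltrDl.
  exact: mulr_gt0.
Unshelve. all: by end_near. Qed.

End ChainFragment.

(** * Relaxed functions and the rising sun *)

Section Relaxation.
Context {R : realType} {X : metricType R} {q : nat}.
Variables (f : X -> 'rV[R]_q) (L delta : R) (w : 'rV[R]_q) (alpha : R).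
Hypothesis lipf : lipschitz2 f L.
Hypothesis delta_gt0 : 0 < delta.
Hypothesis w1 : norm2 w = 1.
Hypothesis cot_gt0 : 0 < cot alpha.
Hypothesis cptX : compact [set: X].
Variable S : set X.
Local Notation D := (dist_cone f delta w alpha).
Local Notation Dmax := (dist_cone_max f L delta w alpha).
Local Notation F := (fun x => dotp w (f x)).

Definition same_ball (r : R) (x y : X) : Prop :=
  exists2 s, S s & ball s r x /\ ball s r y.

(** The price of a step dominates D, and also L d when the two points have no
    common r-ball centred on S, so that the height cannot grow by more than the
    price of such a step. *)
Definition step_cost (r : R) (x y : X) : R :=
  if pselect (same_ball r x y) then D x y else Dmax x y.

Definition chain_value (r : R) (z : nat -> X) (N : nat) : R :=
  F (z 0%N) + \sum_(i < N) step_cost r (z i) (z i.+1).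

Definition relaxation (r : R) (x : X) : R :=
  inf [set chain_value r c.1 c.2 | c in [set c : (nat -> X) * nat | c.1 c.2 = x]].

Lemma step_cost_ge r x y : D x y <= step_cost r x y.
Proof. by rewrite /step_cost; case: pselect => //= _; rewrite le_max lexx orbT. Qed.

Lemma step_cost_le r x y : step_cost r x y <= Dmax x y.
Proof. by rewrite /step_cost; case: pselect => //= _; rewrite le_max lexx orbT. Qed.

Lemma step_cost_sym r x y : step_cost r x y = step_cost r y x.
Proof.
have Dmax_sym : Dmax x y = Dmax y x.
  by rewrite /dist_cone_max dist_cone_sym// metric_sym.
rewrite /step_cost; case: pselect => [[s Ss [xs ys]]|nxy]; case: pselect => /=.
- by move=> _; rewrite dist_cone_sym.
- by move=> nyx; exfalso; apply: nyx; exists s.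
- by move=> [s Ss [xs ys]]; exfalso; apply: nxy; exists s.
- by move=> _; exact: Dmax_sym.
Qed.

Lemma step_cost_ball r s x y : S s -> ball s r x -> ball s r y ->
  step_cost r x y = D x y.
Proof.
move=> Ss sx sy; rewrite /step_cost; case: pselect => // n.
by exfalso; apply: n; exists s.
Qed.

(** Costs are nonnegative and the height is bounded on the compact space X, so
    the infimum that defines the relaxation is a genuine one. *)
Lemma has_inf_chain_value r x :
  has_inf [set chain_value r c.1 c.2 | c in
    [set c : (nat -> X) * nat | c.1 c.2 = x]].
Proof.
split; first by exists (chain_value r (cst x) 0); exists (cst x, 0%N).
have cptF : compact (F @` [set: X]).
  apply: continuous_compact => //; apply: continuous_subspaceT.
  exact: height_continuous lipf w1.
have [M [_ MF]] := compact_bounded cptF.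
exists (- (M + 1)) => _ [[z N] /= _ <-].
have : `|F (z 0%N)| <= M + 1 by apply: MF; [rewrite ltrDl|exists (z 0%N)].
rewrite ler_norml => /andP[FM _]; rewrite (le_trans FM)// lerDl.
apply: sumr_ge0 => i _; apply: le_trans (step_cost_ge _ _ _).
exact: dist_cone_ge0.
Qed.

Lemma relaxation_le r x : relaxation r x <= F x.
Proof.
apply: ge_inf; first exact: (has_inf_chain_value r x).2.
by exists (cst x, 0%N) => //; rewrite /chain_value big_ord0 addr0.
Qed.

Lemma relaxation_step r x y : relaxation r y <= relaxation r x + step_cost r x y.
Proof.
apply/ler_addgt0Pr => e e0.
have [_ [[z N] /= zN <-] ze] := inf_adherent e0 (has_inf_chain_value r x).
pose z' i := if (i <= N)%N then z i else y.
apply: (@le_trans _ _ (chain_value r z' N.+1)).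
  apply: ge_inf; first exact: (has_inf_chain_value r y).2.
  by exists (z', N.+1) => //=; rewrite /z' ltnn.
suff -> : chain_value r z' N.+1 = chain_value r z N + step_cost r x y.
  by move: ze; rewrite -/(relaxation r x); lra.
rewrite /chain_value big_ord_recr/= addrA; congr (_ + _ + _).
  apply: eq_bigr => i _; rewrite /z'.
  by rewrite ltn_ord (ltnW (ltn_ord i)).
by rewrite /z' leqnn ltnn zN.
Qed.

Lemma relaxation_lipschitz r x y :
  `|relaxation r x - relaxation r y| <= step_cost r x y.
Proof.
have := relaxation_step r x y; have := relaxation_step r y x.
rewrite (step_cost_sym r y x) => H1 H2.
by rewrite ler_norml; apply/andP; split; lra.
Qed.

Lemma dist_cone_le_sum r (z : nat -> X) (i j : nat) : (i <= j)%N ->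
  D (z i) (z j) <= \sum_(k < j) step_cost r (z k) (z k.+1)
                   - \sum_(k < i) step_cost r (z k) (z k.+1).
Proof.
elim: j => [|j IH]; first by rewrite leqn0 => /eqP ->; rewrite dist_conexx subrr.
rewrite leq_eqVlt => /predU1P[->|]; first by rewrite dist_conexx subrr.
rewrite ltnS => /IH {}IH; rewrite big_ord_recr/= addrAC.
have := dist_cone_triangle f w delta_gt0 cot_gt0 (z j) (z i) (z j.+1).
move=> /le_trans; apply; apply: lerD IH _.
exact: step_cost_ge.
Qed.

(** A discrete approximation at scale r of a curve in S, parametrised by
    ]0, e], along which the height grows at least as fast as D and as the
    parameter. *)
Definition monotone_net (r e : R) (xi : R -> X) :=
  forall v v', 0 < v -> v <= v' -> v' <= e ->
    [/\ exists2 s, S s & mdist s (xi v) < r,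
        D (xi v) (xi v') <= F (xi v') - F (xi v) &
        v' - v - 2 * `|L| * r <= F (xi v') - F (xi v)].

(** The limit of such nets as r tends to 0. The absolute value makes both
    inequalities symmetric in v and v', hence stable under closure. *)
Definition monotone_curve (e : R) (x : R -> X) :=
  forall v v', 0 < v -> v <= v' -> v' <= e ->
    [/\ S (x v), D (x v) (x v') <= `|F (x v) - F (x v')| &
        v' - v <= `|F (x v) - F (x v')|].

(** idx v is the first time at which the profit phi, that is the height gained
    minus the cost paid, reaches v. Just before, the profit was below v: the
    last step is profitable, hence short and near S, and overshoots v by at
    most 2 |L| r. Between two such times the profit grows, so the height grows
    by more than the cost, which dominates D by the triangle inequality. *)
Lemma rising_sun r e (z : nat -> X) (N : nat) :
  chain_value r z N <= F (z N) - e ->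
  exists xi : R -> X, monotone_net r e xi.
Proof.
move=> zN.
pose c i := \sum_(k < i) step_cost r (z k) (z k.+1).
pose phi i := F (z i) - F (z 0%N) - c i.
have phi0 : phi 0%N = 0 by rewrite /phi /c big_ord0 subrr subr0.
have phiN : e <= phi N by move: zN; rewrite /chain_value -/(c N) /phi; lra.
have H v : exists i, v <= e -> v <= phi i /\ forall j, (j < i)%N -> phi j < v.
  have [ve|//] := leP v e; last by exists 0%N.
  have exi : exists i, v <= phi i by exists N; exact: le_trans phiN.
  exists (ex_minn exi) => _; case: ex_minnP => i vi imin; split => // j ji.
  by rewrite ltNge; apply/negP => /imin; rewrite leqNgt ji.
have [idx Hidx] := choice H.
have step v : 0 < v -> v <= e ->
    (exists2 s, S s & mdist s (z (idx v)) < r) /\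
    phi (idx v) - v <= 2 * `|L| * r.
  move=> v0 ve; have [vi imin] := Hidx v ve.
  case idxE : (idx v) vi imin => [|i] vi imin.
    by move: vi; rewrite phi0 leNgt v0.
  have := imin i (ltnSn i) => phi_i.
  have cS : c i.+1 = c i + step_cost r (z i) (z i.+1) by rewrite /c big_ord_recr.
  have gain : step_cost r (z i) (z i.+1) < F (z i.+1) - F (z i).
    by move: phi_i vi; rewrite /phi cS; lra.
  have lipi : F (z i.+1) - F (z i) <= L * mdist (z i) (z i.+1).
    rewrite (le_trans (ler_norm _))// metric_sym.
    exact: (height_lipschitz lipf w1 (z i.+1) (z i)).
  have [[s Ss [si sS]]|nb] := pselect (same_ball r (z i) (z i.+1)); last first.
    move: gain; rewrite /step_cost; case: pselect => //= _.
    by rewrite ltNge (le_trans lipi)// le_max lexx.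
  move: si sS; rewrite !ballEmdist/= => si sS; split; first by exists s.
  have : phi i.+1 - v <= L * mdist (z i) (z i.+1).
    have := step_cost_ge r (z i) (z i.+1).
    have := dist_cone_ge0 f w delta_gt0 cot_gt0 (z i) (z i.+1).
    by move: phi_i lipi; rewrite /phi cS; lra.
  move/le_trans; apply.
  apply: (@le_trans _ _ (`|L| * mdist (z i) (z i.+1))).
    by rewrite ler_wpM2r ?mdist_ge0// ler_norm.
  rewrite [2 * _]mulrC -mulrA ler_wpM2l//.
  have := metric_triangle (z i) s (z i.+1); rewrite (metric_sym (z i) s).
  by move: si sS; lra.
(* When both parameters share the same first time, the two points coincide and
   v' - v is within the overshoot. *)
exists (fun v => z (idx v)) => v v' v0 vv' v'e.
have ve := le_trans vv' v'e.
have [vS vphi] := step v v0 ve; split => //.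
all: have [vi imin] := Hidx v ve; have [v'j jmin] := Hidx v' v'e.
all: have ij : (idx v <= idx v')%N by
  rewrite leqNgt; apply/negP => /imin; rewrite ltNge (le_trans vv' v'j).
all: have := dist_cone_le_sum r z ij; rewrite -/(c _) -/(c _).
all: have := dist_cone_ge0 f w delta_gt0 cot_gt0 (z (idx v)) (z (idx v')).
all: move: ij; rewrite leq_eqVlt => /predU1P[idxE|/jmin phi_lt].
- by rewrite -idxE dist_conexx !subrr.
- by move: phi_lt v'j; rewrite /phi; lra.
- by move: v'j vphi; rewrite -idxE subrr; lra.
- by move: phi_lt v'j vphi; rewrite /phi; lra.
Qed.

End Relaxation.

(** * Passage to the limit *)

Lemma ultra_fmap {T V : Type} (h : T -> V) (U : set_system T) :
  UltraFilter U -> UltraFilter (h @ U).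
Proof.
move=> UU; split; first exact: fmap_proper_filter.
move=> G GF hUG; rewrite eqEsubset; split => // A GA.
have [//|UnA] := in_ultra_setVsetC (h @^-1` A) UU.
exfalso; apply: (@filter_not_empty _ G).
by rewrite -(setICr A); apply: filterI GA _; exact: hUG.
Qed.

Section Limit.
Context {R : realType} {X : metricType R} {q : nat}.
Variables (f : X -> 'rV[R]_q) (L delta : R) (w : 'rV[R]_q) (alpha : R).
Hypothesis lipf : lipschitz2 f L.
Hypothesis delta_gt0 : 0 < delta.
Hypothesis w1 : norm2 w = 1.
Hypothesis cot_gt0 : 0 < cot alpha.
Hypothesis cptX : compact [set: X].
Variable S : set X.
Hypothesis cptS : compact S.
Local Notation D := (dist_cone f delta w alpha).
Local Notation F := (fun x => dotp w (f x)).
Local Notation B := (`|delta + cot alpha * L| + `|L| + 1).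

(** D p p' - |F p - F p'| is Lipschitz in p and p', so its sign is preserved by
    limits. *)
Lemma dist_cone_perturb x x' y y' e : mdist x y <= e -> mdist x' y' <= e ->
  D x x' - `|F x - F x'| <= D y y' - `|F y - F y'| + 2 * (B * e).
Proof.
move=> xy xy'.
have DF p p' : mdist p p' <= e -> D p p' + `|F p - F p'| <= B * e.
  move=> pp'; have e0 := le_trans (mdist_ge0 p p') pp'.
  have := dist_cone_le_mdist delta lipf w1 cot_gt0 p p'.
  have := height_lipschitz lipf w1 p p' => HF HD.
  apply: le_trans (lerD HD HF) _; rewrite -mulrDl.
  apply: (@le_trans _ _ (B * mdist p p')); last by rewrite ler_wpM2l// addr_ge0.
  rewrite ler_wpM2r ?mdist_ge0// (le_trans (lerD (ler_norm _) (ler_norm _)))//.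
  by rewrite lerDl.
have := DF _ _ xy; have := DF _ _ xy'.
have := dist_cone_triangle f w delta_gt0 cot_gt0 y x x'.
have := dist_cone_triangle f w delta_gt0 cot_gt0 y' y x'.
rewrite (dist_cone_sym _ _ _ _ y' x').
have := ler_distD (F x) (F y) (F y'); have := ler_distD (F x') (F x) (F y').
rewrite (distrC (F y) (F x)).
move: (D x y) (D x' y') (D x x') (D y y') (D y x') `|F x - F y|
  `|F x' - F y'| `|F x - F x'| `|F y - F y'| `|F x - F y'| (B * e).
by move=> *; lra.
Qed.

Lemma height_perturb x x' y y' e : mdist x y <= e -> mdist x' y' <= e ->
  `|F y - F y'| <= `|F x - F x'| + 2 * (`|L| * e).
Proof.
move=> xy xy'.
have HF p p' : mdist p p' <= e -> `|F p - F p'| <= `|L| * e.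
  move=> pp'; rewrite (le_trans (height_lipschitz lipf w1 _ _))//.
  apply: (@le_trans _ _ (`|L| * mdist p p')); last by rewrite ler_wpM2l.
  by rewrite ler_wpM2r ?mdist_ge0// ler_norm.
have := HF _ _ xy; have := HF _ _ xy'.
have := ler_distD (F x) (F y) (F y'); have := ler_distD (F x') (F x) (F y').
by rewrite (distrC (F y) (F x)); lra.
Qed.

(** The points converge for each parameter along one common ultrafilter. Any two
    parameters are thus approximated simultaneously at the same scale, so that
    inequalities between two points pass to the limit, without extraction of
    subsequences over uncountably many parameters. *)
Lemma monotone_net_limit e :
  (forall n, exists xi, monotone_net f L delta w alpha S n.+1%:R^-1 e xi) ->
  exists x, monotone_curve f delta w alpha S e x.
Proof.
move=> /choice[xi Hxi].
have [U [UU ooU]] := ultraFilterLemma (eventually_filter : ProperFilter \oo).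
have Hx v : exists p : X, xi n v @[n --> U] --> p.
  have cX : forall V : set_system X, UltraFilter V -> V setT ->
      [set: X] `&` [set p | V --> p] !=set0.
    by move: cptX; rewrite compact_ultra; apply.
  have [//|p [_ xp]] := cX _ (ultra_fmap (xi^~ v) UU); last by exists p.
  exact: filterT.
have [x Hx'] := choice Hx.
exists x => v v' v0 vv' v'e.
have close e' : 0 < e' -> exists n, [/\ mdist (x v) (xi n v) <= e',
    mdist (x v') (xi n v') <= e' & n.+1%:R^-1 <= e'].
  move=> e'0; have UP : ProperFilter U by exact: ultra_proper.
  apply: (@filter_ex _ U UP).
  have b u : \forall n \near U, mdist (x u) (xi n u) <= e'.
    have xu : nbhs (x u) (ball (x u) e') by exact: nbhsx_ballx.
    have : U [set n | ball (x u) e' (xi n u)] := Hx' u _ xu.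
    by apply: filterS => n; rewrite /= ballEmdist => /ltW.
  have c : \forall n \near U, n.+1%:R^-1 <= e'.
    apply: ooU; near=> n; apply/ltW; near: n.
    exact: near_infty_natSinv_lt (PosNum e'0).
  by near=> n; split; near: n.
have B0 : 0 < B by rewrite ltr_wpDl// addr_ge0.
split.
- have closedS : closed S by apply: compact_closed => //; exact: metric_hausdorff.
  rewrite (closure_id S).1// => V /nbhs_ballP[e' /= e'0 eV].
  have [|n [xv _ ne]] := close (e' / 3); first by rewrite divr_gt0.
  have [[s Ss sxi] _ _] := Hxi n v v' v0 vv' v'e.
  exists s; split => //; apply: eV; rewrite ballEmdist/=.
  have := metric_triangle (x v) (xi n v) s; rewrite (metric_sym (xi n v)).
  by move: xv (lt_le_trans sxi ne); lra.
- apply/ler_addgt0Pr => e' e'0.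
  have [|n [xv xv' _]] := close (e' / (2 * B)); first by rewrite divr_gt0// mulr_gt0.
  have [_ Dn _] := Hxi n v v' v0 vv' v'e.
  have := dist_cone_perturb xv xv'.
  have -> : 2 * (B * (e' / (2 * B))) = e' by field; rewrite gt_eqF.
  have := ler_norm (F (xi n v') - F (xi n v)); rewrite distrC.
  by move: Dn; lra.
- apply/ler_addgt0Pr => e' e'0.
  have L4 : 0 < 4 * `|L| + 1 by rewrite ltr_wpDl// mulr_ge0.
  have [|n [xv xv' ne]] := close (e' / (4 * `|L| + 1)); first by rewrite divr_gt0.
  have [_ _ Fn] := Hxi n v v' v0 vv' v'e.
  have := height_perturb xv xv'.
  have : 2 * `|L| * n.+1%:R^-1 <= 2 * `|L| * (e' / (4 * `|L| + 1)).
    by rewrite ler_wpM2l// mulr_ge0.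
  have : 4 * `|L| * (e' / (4 * `|L| + 1)) <= e'.
    rewrite mulrA ler_pdivrMr// mulrC.
    by rewrite ler_pM2l// lerDl.
  have := ler_norm (F (xi n v') - F (xi n v)); rewrite distrC.
  move: Fn; rewrite -!(mulrA _ `|L|).
  by move: (`|L| * (e' / _)) (`|L| * _^-1) => ? ?; lra.
Unshelve. all: by end_near. Qed.

End Limit.

Section NoMonotoneCurve.
Context {R : realType} {X : metricType R} {q : nat}.
Variables (f : X -> 'rV[R]_q) (L delta : R) (w : 'rV[R]_q) (alpha : R).
Hypothesis lipf : lipschitz2 f L.
Hypothesis delta_gt0 : 0 < delta.
Hypothesis w1 : norm2 w = 1.
Hypothesis cot_gt0 : 0 < cot alpha.
Hypothesis tan_cot : tan alpha * cot alpha = 1.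
Variable S : set X.
Hypothesis cptS : compact S.
Local Notation D := (dist_cone f delta w alpha).
Local Notation F := (fun x => dotp w (f x)).
Local Notation B := (`|delta + cot alpha * L| + `|L| + 1).

(** The closure of the curve would be the image of a fragment of the family,
    and S meets it in a set of positive Hausdorff measure. *)
Lemma null_no_monotone_curve e (x : R -> X) : 0 < e ->
  family_null (Frag f delta w alpha) S ->
  ~ monotone_curve f delta w alpha S e x.
Proof.
move=> e0 nullS Hx.
have xS v : 0 < v <= e -> S (x v).
  by move=> /andP[v0 ve]; have [] := Hx v v v0 (lexx _) ve.
have xD v v' : 0 < v <= e -> 0 < v' <= e ->
    D (x v) (x v') <= `|F (x v) - F (x v')| /\ `|v - v'| <= `|F (x v) - F (x v')|.
  move=> /andP[v0 ve] /andP[v'0 v'e]; have [vv'|/ltW v'v] := leP v v'.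
    have [_ ? ?] := Hx v v' v0 vv' v'e; split => //.
    by rewrite distrC ger0_norm// subr_ge0.
  have [_ ? ?] := Hx v' v v'0 v'v ve; split.
    by rewrite dist_cone_sym distrC.
  by rewrite ger0_norm ?subr_ge0// distrC.
pose I := [set v | 0 < v <= e].
pose G := closure (x @` I).
have closedS : closed S by apply: compact_closed => //; exact: metric_hausdorff.
have GS : G `<=` S.
  rewrite [S in _ `<=` S](closure_id S).1//; apply: closure_subset.
  by move=> _ [v Iv <-]; exact: xS.
have cptG : compact G by apply: subclosed_compact cptS GS; exact: closed_closure.
have xG v : I v -> G (x v) by move=> Iv; apply: subset_closure; exists v.
(* The chain condition is closed on pairs of points, hence passes from the range
   of the curve to its closure. *)
have chainG p p' : G p -> G p' -> D p p' <= `|F p - F p'|.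
  move=> Gp Gp'; apply/ler_addgt0Pr => e' e'0.
  have B0 : 0 < B by rewrite ltr_wpDl// addr_ge0.
  have e2 : 0 < e' / (2 * B) by rewrite divr_gt0// mulr_gt0.
  have approx r : G r -> exists2 v, I v & mdist r (x v) <= e' / (2 * B).
    move=> /(_ (ball r (e' / (2 * B))))[].
      exact: nbhsx_ballx.
    move=> _ [[v Iv <-]]; rewrite ballEmdist/= => rv.
    by exists v => //; exact: ltW.
  have [v Iv pv] := approx _ Gp; have [v' Iv' p'v'] := approx _ Gp'.
  have [Dv _] := xD v v' Iv Iv'.
  have := dist_cone_perturb lipf delta_gt0 w1 cot_gt0 pv p'v'.
  have -> : 2 * (B * (e' / (2 * B))) = e' by field; rewrite gt_eqF.
  by move: Dv; lra.
have height_gt0 : (0 < lebesgue_measure (F @` G))%E.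
  apply: (@expanding_image_gt0 _ (F \o x) _ e) => //.
    by move=> v v' Iv Iv'; have [] := xD v v' Iv Iv'.
  by move=> v Iv; exists (x v) => //; exact: xG.
have [gamma Fgamma gammaG] :=
  chain_fragment lipf delta_gt0 w1 cot_gt0 tan_cot cptG chainG height_gt0.
have := nullS _ Fgamma; rewrite gammaG.
apply: (@expanding_hausdorff1_neq0 _ _ x _ e (`|L| + 1)) => //.
- move=> v v' Iv Iv'; have [_ /le_trans] := xD v v' Iv Iv'; apply.
  rewrite (le_trans (height_lipschitz lipf w1 _ _))// ler_wpM2r ?mdist_ge0//.
  by rewrite (le_trans (ler_norm _))// lerDl.
- by move=> v Iv; split; [exact: xS|exact: xG].
Qed.

End NoMonotoneCurve.

(** * The approximating functions *)

Theorem theorem3p66 (R : realType) (X : pmetricType R) (q : nat)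
    (f : X -> 'rV[R]_q) (L : R) (S : set X)
    (mu : {measure set (borelType X) -> \bar R})
    (delta : R) (w : 'rV[R]_q) (alpha : R)
    (cptX : compact [set: X])
    (lipf : lipschitz2 f L)
    (cptS : compact S)
    (radon_mu : radon mu)
    (delta_gt0 : 0 < delta)
    (norm_w : norm2 w = 1)
    (alpha_gt0 : 0 < alpha) (alpha_lt : alpha < pi / 2)
    (nullS : family_null (Frag f delta w alpha) S) :
  exists g : nat -> X -> R,
    [/\ forall k, lipschitz_wrt (dist_cone_max f L delta w alpha) 1 setT (g k),
        weak_star_cvg g (fun x => dotp w (f x)) &
        forall k, ae_locally_lip1 mu S (dist_cone f delta w alpha) (g k)].
Proof.
have sin_gt0 : 0 < sin alpha by rewrite sin_gt0_pihalf// alpha_gt0.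
have cos_gt0 : 0 < cos alpha.
  rewrite cos_gt0_pihalf// alpha_lt andbT (lt_trans _ alpha_gt0)//.
  by rewrite oppr_lt0 divr_gt0// pi_gt0.
have cot_gt0 : 0 < cot alpha by rewrite divr_gt0.
have tan_cot : tan alpha * cot alpha = 1.
  by rewrite /tan /cot; field; rewrite !gt_eqF.
pose g k := relaxation f L delta w alpha S k.+1%:R^-1.
have g_lip k x y : `|g k x - g k y| <= step_cost f L delta w alpha S k.+1%:R^-1 x y.
  exact: relaxation_lipschitz.
have g_le k x : g k x <= dotp w (f x) by exact: relaxation_le.
exists g; split.
- by move=> k x y _ _; rewrite mul1r (le_trans (g_lip k x y))// step_cost_le.
- split.
    exists (Num.max L (delta + cot alpha * L)) => k x y _ _.
    apply: le_trans (g_lip k x y) _; apply: le_trans (step_cost_le _ _ _ _ _ _ _ _ _) _.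
    rewrite /dist_cone_max ge_max maxr_pMl ?mdist_ge0// !le_max lexx/=.
    by rewrite (dist_cone_le_mdist _ lipf norm_w cot_gt0) orbT.
  move=> x; apply/cvgrPdist_le => e e0; apply: contrapT => ncvg.
  suff [xi Hxi] : exists xi, monotone_curve f delta w alpha S e xi.
    exact: (null_no_monotone_curve lipf delta_gt0 norm_w cot_gt0 tan_cot cptS
      e0 nullS Hxi).
  apply: (monotone_net_limit lipf delta_gt0 norm_w cot_gt0 cptX cptS) => m.
  have [n mn gn] : exists2 n, (m <= n)%N & g n x < dotp w (f x) - e.
    apply: contrapT => H; apply: ncvg; near=> n.
    rewrite ger0_norm ?subr_ge0// lerBlDr -lerBlDl leNgt; apply/negP => gn.
    by apply: H; exists n => //; near: n; exact: nbhs_infty_ge.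
  have gap : 0 < dotp w (f x) - e - g n x by rewrite subr_gt0.
  have hinf := has_inf_chain_value lipf delta_gt0 norm_w cot_gt0 cptX S n.+1%:R^-1 x.
  have [_ [[z N] /= zN <-] zlt'] := inf_adherent gap hinf; move: zlt'.
  rewrite -/(relaxation _ _ _ _ _ _ _ _) -/(g n x) addrC subrK -zN => /ltW zlt.
  have [xi Hxi] := rising_sun lipf delta_gt0 norm_w cot_gt0 zlt.
  (* A net at the finer scale 1/(n+1) is also one at the scale 1/(m+1). *)
  have nm : n.+1%:R^-1 <= m.+1%:R^-1 :> R by rewrite lef_pV2 ?posrE// ler_nat.
  exists xi => v v' v0 vv' v'e; have [[s Ss sxi] Dv Fv] := Hxi v v' v0 vv' v'e.
  split => //; first by exists s => //; exact: lt_le_trans nm.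
  apply: le_trans Fv; rewrite lerD2l lerN2 ler_wpM2l// mulr_ge0//.
- move=> k; apply: aeW => x Sx.
  exists k.+1%:R^-1; first by rewrite invr_gt0.
  move=> y z xy xz; rewrite mul1r; have := g_lip k y z.
  by rewrite (step_cost_ball _ _ _ _ _ Sx xy xz).
Unshelve. all: by end_near. Qed.
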